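(* Suppose $\mathbf{C}=\mathbf{V}^\top\mathbf{V}$ with $\mathbf{V}\in\mathbb{R}^{d\times d}$ full rank. Then for any $\mathbf{x}\in\mathcal{X}$ and any $\boldsymbol{\rho},\boldsymbol{\omega}\in\mathbb{R}^d$, there exists $\kappa\in\mathbb{R}$ such that $$f_{\text{linx-d}}(\mathbf{x},\boldsymbol{\rho}+\kappa\mathbf{1},\boldsymbol{\omega})\ \ge\ \tfrac12\big(f_{\Gamma\text{-g}}(\mathbf{x},\boldsymbol{\rho})+f_{\Gamma^c\text{-g}}(\mathbf{x},\boldsymbol{\omega})\big).$$
   Context: $\mathcal{X}=\{\mathbf{x}\in[0,1]^d:\ \mathbf{1}^\top\mathbf{x}=s,\ \mathbf{A}\mathbf{x}\le\mathbf{b}\}$ for an integer $1\le s\le d-1$, a matrix $\mathbf{A}$ and a vector $\mathbf{b}$. $\mathrm{Diag}(\mathbf{x})$ is the diagonal matrix with diagonal $\mathbf{x}$, $\mathbf{1}$ is the all-ones vector, $\exp$ is applied componentwise, $\boldsymbol{\lambda}(\mathbf{X})$ is the vector of eigenvalues of the symmetric matrix $\mathbf{X}$ in nonincreasing order. $\mathbb{K}_{o,d}=\{\mathbf{x}\in\mathbb{R}^d: x_1\ge\dots\ge x_d\}$. $\mathbf{u}\succcurlyeq_m\mathbf{w}$ ($\mathbf{u}$ majorizes $\mathbf{w}$) means $\sum_i u_i=\sum_i w_i$ and for each $j\le d-1$ the sum of the $j$ largest entries of $\mathbf{u}$ is at least that of $\mathbf{w}$. For an integer $1\le r\le d$ and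 $\mathbf{X}\in\mathbb{S}^d$ (real symmetric $d\times d$), with $-\log t=+\infty$ for $t\le 0$, $$G_r(\mathbf{X})=\min_{\boldsymbol{\xi}\in\mathbb{R}^d_+}\Big\{-\sum_{i=1}^r\log\xi_i:\ \boldsymbol{\xi}\succcurlyeq_m\boldsymbol{\lambda}(\mathbf{X}),\ \boldsymbol{\xi}\in\mathbb{K}_{o,d}\Big\}.$$ The three functions are $$f_{\text{linx-d}}(\mathbf{x},\boldsymbol{\rho},\boldsymbol{\omega})=-\tfrac12\log\det\!\big(\mathbf{C}\,\mathrm{Diag}(\exp(\boldsymbol{\rho}))\mathrm{Diag}(\mathbf{x})\mathbf{C}+\mathrm{Diag}(\exp(\boldsymbol{\omega}))\mathrm{Diag}(\mathbf{1}-\mathbf{x})\big)+\tfrac12\sum_{i}x_i\rho_i+\tfrac12\sum_{i}(1-x_i)\omega_i,$$ $$f_{\Gamma\text{-g}}(\mathbf{x},\boldsymbol{\rho})=G_s\big(\mathbf{V}\mathrm{Diag}(\exp(\boldsymbol{\rho}))\mathrm{Diag}(\mathbf{x})\mathbf{V}^\top\big)+\sum_i x_i\rho_i,$$ $$f_{\Gamma^c\text{-g}}(\mathbf{x},\boldsymbol{\omega})=G_{d-s}\big(\mathbf{V}^{-\top}\mathrm{Diag}(\exp(\boldsymbol{\omega}))\mathrm{Diag}(\mathbf{1}-\mathbf{x})\mathbf{V}^{-1}\big)-\log\det(\mathbf{C})+\sum_i(1-x_i)\omega_i .$$ *)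

(* Defs.v *)
From HB Require Import structures.
From mathcomp Require Import all_boot all_order all_algebra.
From mathcomp Require Import all_classical all_reals all_analysis.

Set Implicit Arguments.
Unset Strict Implicit.
Unset Printing Implicit Defensive.

Import Order.TTheory GRing.Theory Num.Theory.

Local Open Scope classical_set_scope.
Local Open Scope ring_scope.

Definition Diag (R : realType) (d : nat) (v : 'cV[R]_d) : 'M[R]_d :=
  diag_mx v^T.

Definition vexp (R : realType) (d : nat) (v : 'cV[R]_d) : 'cV[R]_d :=
  map_mx expR v.

Definition ones (R : realType) (d : nat) : 'cV[R]_d := const_mx 1.

(* The library's [ln] is 0 on nonpositive reals, hence the case distinction. *)
Definition neglog (R : realType) (t : R) : \bar R :=
  if 0 < t then (- ln t)%:E else +oo%E.

Definition polytope (R : realType) (d s m : nat)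
    (A : 'M[R]_(m, d)) (b : 'cV[R]_m) : set 'cV[R]_d :=
  [set x : 'cV[R]_d | [/\ forall i, 0 <= x i 0 <= 1,
               \sum_i x i 0 = s%:R
             & forall k, (A *m x) k 0 <= b k 0]].

(* The cone K_{o,d}. *)
Definition nonincreasing_vec (R : realType) (d : nat) (x : 'cV[R]_d) : Prop :=
  forall i j : 'I_d, (i <= j)%N -> x j 0 <= x i 0.

(* Eigenvalues are counted with algebraic multiplicity.  For symmetric [X] the
   characteristic polynomial splits over [R], so such a vector exists, and it is
   unique because it is ordered; the default value 0 only matters for matrices
   whose characteristic polynomial does not split. *)
Definition eigenvalues (R : realType) (d : nat) (X : 'M[R]_d) : 'cV[R]_d :=
  xget 0 [set l : 'cV[R]_d | nonincreasing_vec l /\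
                             char_poly X = \prod_i ('X - (l i 0)%:P)].

Definition sum_largest (R : realType) (d : nat) (u : 'cV[R]_d) (j : nat) : R :=
  \sum_(y <- take j (sort >=%R [seq u i 0 | i <- enum 'I_d])) y.

Definition majorizes (R : realType) (d : nat) (u w : 'cV[R]_d) : Prop :=
  \sum_i u i 0 = \sum_i w i 0 /\
  forall j : nat, (1 <= j <= d - 1)%N -> sum_largest w j <= sum_largest u j.

(* The infimum is attained whenever the constraint set is nonempty (the set is
   compact and the objective is lower semicontinuous), so it is the minimum; it
   is +oo when no vector is admissible. *)
Definition G (R : realType) (d r : nat) (X : 'M[R]_d) : \bar R :=
  ereal_inf [set (\sum_(i < d | (i < r)%N) neglog (xi i 0%R))%E | xi in
    [set xi : 'cV[R]_d | [/\ forall i, 0 <= xi i 0,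
                             majorizes xi (eigenvalues X)
                           & nonincreasing_vec xi]]].

Definition f_linx_d (R : realType) (d : nat) (C : 'M[R]_d)
    (x rho omega : 'cV[R]_d) : \bar R :=
  ((2^-1)%:E * neglog (\det (C *m Diag (vexp rho) *m Diag x *m C
                             + Diag (vexp omega) *m Diag (ones R d - x)))
   + (2^-1 * \sum_i x i 0 * rho i 0)%:E
   + (2^-1 * \sum_i (1 - x i 0) * omega i 0)%:E)%E.

Definition f_Gamma_g (R : realType) (d s : nat) (V : 'M[R]_d)
    (x rho : 'cV[R]_d) : \bar R :=
  (G s (V *m Diag (vexp rho) *m Diag x *m V^T)
   + (\sum_i x i 0 * rho i 0)%:E)%E.

Definition f_Gammac_g (R : realType) (d s : nat) (C V : 'M[R]_d)
    (x omega : 'cV[R]_d) : \bar R :=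
  (G (d - s) ((invmx V)^T *m Diag (vexp omega) *m Diag (ones R d - x)
              *m invmx V)
   + neglog (\det C)
   + (\sum_i (1 - x i 0) * omega i 0)%:E)%E.

(* Main.v *)
Require Import Defs.
From HB Require Import structures.
From mathcomp Require Import all_boot all_order all_algebra.
From mathcomp Require Import all_classical all_reals all_analysis.
From mathcomp Require Import perm complex ring lra.

Set Implicit Arguments.
Unset Strict Implicit.
Unset Printing Implicit Defensive.

Import Order.TTheory GRing.Theory Num.Theory.
Import numFieldNormedType.Exports.

Local Open Scope classical_set_scope.
Local Open Scope ring_scope.
Local Open Scope sesquilinear_scope.

(** Put X = V P V^T and Y = V^-T Q V^-1, where P = Diag(exp rho) Diag(x) and
    Q = Diag(exp omega) Diag(1 - x).  Since C = V^T V, the matrix under the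
    determinant of the linx function is V^T (e^kappa X + Y) V, so everything
    reduces to an upper bound on det(e^kappa X + Y) in terms of the spectra of
    the positive semidefinite matrices X and Y.

    Let l be the spectrum of X.  As X has rank at least s, there is a water
    level t > 0 with sum_j min(l_j, t) = s t ([water_level]).  The vector whose
    first s entries are max(l_j, t) and whose other entries vanish is then
    admissible in the problem defining G_s(X), which yields
    G_s(X) <= - s log t - sum_j log alpha_j with alpha_j = max(l_j, t) / t
    ([G_water_level]).  In the same way Y has a water level u for d - s, with
    excess factors beta_j.

    The choice e^kappa = u / t makes both water levels equal: e^kappa X + Y is
    u (X / t + Y / u), and the claim becomes
      det(X / t + Y / u) <= (prod_j alpha_j) (prod_j beta_j).
    The eigenvalues of X / t are alpha_j m_j with m_j = min(l_j, t) / t, those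
    of Y / u are beta_j k_j, and the m_j and k_j add up to s + (d - s) = d.
    In an eigenbasis of X / t, the determinant is an affine function of each
    eigenvalue alone, and it is nonnegative when that eigenvalue is set to 0;
    hence multiplying the eigenvalue by c >= 1 multiplies the determinant by at
    most c ([det_diagD_scale1]).  This extracts all the factors alpha_j, then,
    in an eigenbasis of Y / u, all the factors beta_j.  What remains is the
    determinant of a positive semidefinite matrix of trace at most d, which is
    at most 1 by the inequality between arithmetic and geometric means
    ([psdmx_det_le1]).

    Only unitary diagonalizations and inequalities between determinants are
    involved, so this part takes place over a numerically closed field, where
    the spectral theorem for normal matrices applies; it is used with K = R[i],
    the real matrices being mapped there by the inclusion of R. *)

(** * Positive semidefinite matrices *)

Definition psdmx (K : numClosedFieldType) n (Z : 'M[K]_n) : Prop :=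
  Z ^t* = Z /\ forall v : 'rV[K]_n, 0 <= (v *m Z *m v ^t*) 0 0.

Lemma psdmxD (K : numClosedFieldType) n (Y Z : 'M[K]_n) :
  psdmx Y -> psdmx Z -> psdmx (Y + Z).
Proof.
move=> [Yh Y0] [Zh Z0]; split; first by rewrite linearD /= map_mxD Yh Zh.
by move=> v; rewrite mulmxDr mulmxDl mxE addr_ge0.
Qed.

Lemma psdmx_congr (K : numClosedFieldType) m n (M : 'M[K]_(m, n)) (Z : 'M[K]_n) :
  psdmx Z -> psdmx (M *m Z *m M ^t*).
Proof.
move=> [Zh Z0]; split.
  by rewrite !trmx_mul !map_mxM /= trmxCK Zh mulmxA.
by move=> v; have := Z0 (v *m M); rewrite trmx_mul map_mxM /= !mulmxA.
Qed.

Lemma psdmx_diag (K : numClosedFieldType) n (a : 'rV[K]_n) :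
  (forall i, 0 <= a 0 i) -> psdmx (diag_mx a).
Proof.
move=> a0; split.
  rewrite tr_diag_mx map_diag_mx; congr diag_mx; apply/rowP => i.
  by rewrite mxE; apply/CrealP/ger0_real/a0.
move=> v; rewrite mxE sumr_ge0// => i _.
by rewrite mul_mx_diag !mxE mulrAC mulr_ge0// mul_conjC_ge0.
Qed.

(** The spectral theorem gives Z = U^* diag(z) U; each z_i is the value of the
    quadratic form of Z at the i-th row of U, hence nonnegative. *)
Lemma psdmx_spectral (K : numClosedFieldType) n (Z : 'M[K]_n) : psdmx Z ->
  exists U : 'M[K]_n, exists z : 'rV[K]_n,
    [/\ U \is unitarymx, Z = U ^t* *m diag_mx z *m U & forall i, 0 <= z 0 i].
Proof.
move=> [Zh Z0].
have /orthomx_spectralP Zn : Z \is normalmx by apply/normalmxP; rewrite Zh.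
have Uu := spectral_unitarymx Z; rewrite invmx_unitary// in Zn.
set U := spectralmx Z in Zn Uu; set z := spectral_diag Z in Zn.
exists U, z; split => // i.
have := Z0 (row i U); rewrite Zn !mulmxA.
rewrite -row_mul (unitarymxP Uu) row1.
have -> : row i U = delta_mx 0 i *m U by rewrite rowE.
rewrite trmx_mul map_mxM /= !mulmxA mulmxtVK// mul_mx_diag mxE (bigD1 i)//=.
rewrite big1 ?addr0 => [|j ji]; last by rewrite !mxE (negPf ji) andbF !mul0r.
by rewrite !mxE !eqxx mul1r conjC1 mulr1.
Qed.

Lemma det_unitary_conj (K : numClosedFieldType) n (U Z : 'M[K]_n) :
  U \is unitarymx -> \det (U ^t* *m Z *m U) = \det Z.
Proof.
move=> /unitarymxP/(congr1 determinant); rewrite !det_mulmx det1 => UU.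
by rewrite mulrC mulrA UU mul1r.
Qed.

Lemma trace_unitary_conj (K : numClosedFieldType) n (U Z : 'M[K]_n) :
  U \is unitarymx -> \tr (U ^t* *m Z *m U) = \tr Z.
Proof. by move=> /unitarymxP UU; rewrite mxtrace_mulC mulmxA UU mul1mx. Qed.

Lemma psdmx_det_ge0 (K : numClosedFieldType) n (Z : 'M[K]_n) :
  psdmx Z -> 0 <= \det Z.
Proof.
move=> /psdmx_spectral[U [z [Uu -> z0]]].
by rewrite det_unitary_conj// det_diag prodr_ge0.
Qed.

(** The determinant and the trace are the product and the sum of n nonnegative
    eigenvalues, whose arithmetic mean is at most 1. *)
Lemma psdmx_det_le1 (K : numClosedFieldType) n (Z : 'M[K]_n) :
  psdmx Z -> \tr Z <= n%:R -> \det Z <= 1.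
Proof.
move=> /psdmx_spectral[U [z [Uu -> z0]]].
rewrite det_unitary_conj// trace_unitary_conj// mxtrace_diag det_diag => zn.
case: n => [|n] in Z U z Uu z0 zn *; first by rewrite big_ord0.
have /leifP := @leif_AGM K 'I_n.+1 predT (fun i => z 0 i) (fun i _ => z0 i).
have le : forall x y (C : bool), (if C then x == y else x < y) -> (x : K) <= y.
  by move=> x y [/eqP->|/ltW].
move=> /le /le_trans; apply.
rewrite exprn_ile1// ?divr_ge0 ?sumr_ge0//.
by rewrite ler_pdivrMr ?ltr0n ?card_ord// mul1r.
Qed.

(** * Scaling eigenvalues in the determinant of a sum *)

(** By linearity in the i-th row, the determinant is an affine function
    f(t) = f(0) + t f' of the i-th diagonal entry t, and f(0) >= 0 because the
    matrix is still positive semidefinite at t = 0; so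
    f(c t) = c f(t) + (1 - c) f(0) <= c f(t). *)
Lemma det_diagD_scale1 (K : numClosedFieldType) n (a a' : 'rV[K]_n)
    (B : 'M[K]_n) (i : 'I_n) (c : K) :
  psdmx B -> (forall j, 0 <= a 0 j) -> 1 <= c ->
  a' 0 i = c * a 0 i -> (forall j, j != i -> a' 0 j = a 0 j) ->
  \det (diag_mx a' + B) <= c * \det (diag_mx a + B).
Proof.
move=> Bp a0 c1 a'i a'j.
pose a'' := \row_j (if j == i then 0 else a 0 j).
have E : \det (diag_mx a' + B) =
    c * \det (diag_mx a + B) + (1 - c) * \det (diag_mx a'' + B).
  apply: (@determinant_multilinear _ _ _ _ _ i).
  - apply/rowP => j; rewrite !mxE eqxx a'i; case: eqP => _; rewrite ?mulr1n ?mulr0n.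
      by rewrite !add0r mulrDr -addrA -mulrDl addrCA subrr addr0 mul1r.
    by rewrite !add0r -mulrDl addrCA subrr addr0 mul1r.
  - by apply/matrixP => k j; rewrite !mxE a'j// eq_sym neq_lift.
  - by apply/matrixP => k j; rewrite !mxE a'j eq_sym ?neq_lift// (negPf (neq_lift _ _)).
rewrite E gerDl mulr_le0_ge0 ?subr_le0//.
apply/psdmx_det_ge0/psdmxD => //; apply: psdmx_diag => j.
by rewrite mxE; case: ifP.
Qed.

Lemma det_diagD_scale (K : numClosedFieldType) n (c a : 'I_n -> K)
    (B : 'M[K]_n) :
  psdmx B -> (forall j, 0 <= a j) -> (forall j, 1 <= c j) ->
  \det (diag_mx (\row_j (c j * a j)) + B)
    <= (\prod_j c j) * \det (diag_mx (\row_j a j) + B).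
Proof.
move=> Bp a0 c1.
(* The first k coordinates are already scaled. *)
pose b k : 'rV[K]_n := \row_j ((if (j < k)%N then c j else 1) * a j).
have b0 k j : 0 <= b k 0 j.
  by rewrite mxE mulr_ge0//; case: ifP => // _; apply: le_trans (c1 j).
have H k : (k <= n)%N -> \det (diag_mx (b k) + B)
    <= (\prod_(j < n | (j < k)%N) c j) * \det (diag_mx (\row_j a j) + B).
  elim: k => [_|k IH kn].
    rewrite big_pred0// mul1r le_eqVlt; apply/orP; left; apply/eqP.
    by congr (\det (diag_mx _ + _)); apply/rowP => j; rewrite !mxE mul1r.
  have := @det_diagD_scale1 _ _ (b k) (b k.+1) _ (Ordinal kn) (c (Ordinal kn)) Bp (b0 k) (c1 _).
  rewrite !mxE /= ltnn ltnSn mul1r => /(_ erefl) step.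
  apply: (le_trans (step _)).
    move=> j jk; rewrite !mxE ltnS leq_eqVlt.
    by have /negPf-> : (j : nat) != k by apply: contraNneq jk => jk; apply/eqP/val_inj.
  rewrite [X in _ <= X * _](bigD1 (Ordinal kn))//= ?ltnSn// -mulrA ler_wpM2l//.
    by apply: le_trans (c1 _).
  have -> : \prod_(i < n | (i < k.+1)%N && (i != Ordinal kn)) c i
      = \prod_(i < n | (i < k)%N) c i.
    by apply: eq_bigl => j; rewrite -val_eqE /= ltnS [RHS]ltn_neqAle andbC.
  exact: IH (ltnW kn).
have := H n (leqnn n).
have -> : \prod_(j < n | (j < n)%N) c j = \prod_j c j.
  by apply: eq_bigl => j; rewrite ltn_ord.
by congr (\det (diag_mx _ + _) <= _); apply/rowP => j; rewrite !mxE ltn_ord.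
Qed.

(** [det_diagD_scale] in an orthonormal basis that diagonalizes the first
    summand; positive semidefiniteness of [B] survives the change of basis. *)
Lemma det_unitaryD_scale (K : numClosedFieldType) n (U B : 'M[K]_n)
    (c a : 'I_n -> K) :
  U \is unitarymx -> psdmx B -> (forall j, 0 <= a j) -> (forall j, 1 <= c j) ->
  \det (U ^t* *m diag_mx (\row_j (c j * a j)) *m U + B)
    <= (\prod_j c j) * \det (U ^t* *m diag_mx (\row_j a j) *m U + B).
Proof.
move=> Uu Bp a0 c1.
have BE : B = U ^t* *m (U *m B *m U ^t*) *m U.
  by rewrite !mulmxA mulmxKtV// -invmx_unitary// mulVmx ?mul1mx// unitarymx_unit.
rewrite {1 2}BE -!mulmxDl -!mulmxDr !det_unitary_conj//.
by apply: det_diagD_scale => //; exact: psdmx_congr.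
Qed.

(** The factors [al] are pulled out while the second summand is unchanged, then
    the factors [be] while the first summand has the truncated spectrum [m]; what
    is left has trace at most n, hence determinant at most 1. *)
Lemma det_unitaryD_le (K : numClosedFieldType) n (U W : 'M[K]_n)
    (al m be k : 'I_n -> K) :
  U \is unitarymx -> W \is unitarymx ->
  (forall j, 0 <= m j) -> (forall j, 1 <= al j) ->
  (forall j, 0 <= k j) -> (forall j, 1 <= be j) ->
  \sum_j m j + \sum_j k j <= n%:R ->
  \det (U ^t* *m diag_mx (\row_j (al j * m j)) *m U
        + W ^t* *m diag_mx (\row_j (be j * k j)) *m W)
    <= (\prod_j al j) * (\prod_j be j).
Proof.
move=> Uu Wu m0 al1 k0 be1 mk.
have psdU (Q : 'M[K]_n) (a : 'I_n -> K) : (forall j, 0 <= a j) ->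
    psdmx (Q ^t* *m diag_mx (\row_j a j) *m Q).
  move=> a0; rewrite -[in X in _ *m X](trmxCK Q); apply: psdmx_congr.
  by apply: psdmx_diag => j; rewrite mxE.
have ge0 (c : K) : 1 <= c -> 0 <= c by apply: le_trans.
apply: le_trans (det_unitaryD_scale _ _ _ _) _ => //.
  by apply: psdU => j; rewrite mulr_ge0// ge0.
apply: ler_wpM2l; first by apply: prodr_ge0 => j _; exact: ge0.
rewrite addrC; apply: le_trans (det_unitaryD_scale _ _ _ _) _ => //.
  exact: psdU.
rewrite -[leRHS]mulr1 ler_wpM2l//; first by apply: prodr_ge0 => j _; exact: ge0.
apply: psdmx_det_le1; first by apply: psdmxD; exact: psdU.
rewrite mxtraceD !trace_unitary_conj// !mxtrace_diag addrC.
by apply: le_trans mk; rewrite lerD// ler_sum// => j _; rewrite mxE.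
Qed.

(** * Spectra of real positive semidefinite matrices *)

Lemma char_poly_similar (F : comNzRingType) n (L M A : 'M[F]_n) :
  L *m M = 1%:M -> char_poly (L *m A *m M) = char_poly A.
Proof.
move=> LM; rewrite /char_poly.
have -> : char_poly_mx (L *m A *m M)
    = map_mx polyC L *m char_poly_mx A *m map_mx polyC M.
  rewrite /char_poly_mx mulmxBr mulmxBl -scalemx1 -scalemxAr mulmx1 -scalemxAl.
  by rewrite -!map_mxM LM map_mx1.
by rewrite !det_mulmx mulrAC -det_mulmx -map_mxM LM map_mx1 det1 mul1r.
Qed.

Lemma char_poly_diag (F : comNzRingType) n (a : 'rV[F]_n) :
  char_poly (diag_mx a) = \prod_i ('X - (a 0 i)%:P).
Proof.
rewrite char_poly_trig; first by apply: eq_bigr => i _; rewrite mxE eqxx.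
by apply/is_trig_mxP => i j ij; rewrite mxE -val_eqE /= ltn_eqF.
Qed.

(** Sorting the roots of a split characteristic polynomial provides a vector
    with the two properties that define [eigenvalues]. *)
Lemma eigenvaluesP (R : realType) d (X : 'M[R]_d) :
  (exists r : 'I_d -> R, char_poly X = \prod_i ('X - (r i)%:P)) ->
  nonincreasing_vec (eigenvalues X) /\
  char_poly X = \prod_i ('X - (eigenvalues X i 0)%:P).
Proof.
move=> [r Xr].
apply: (@xgetPex _ 0 [set l : 'cV[R]_d | nonincreasing_vec l /\
                             char_poly X = \prod_i ('X - (l i 0)%:P)]).
pose t := sort >=%R (codom r).
have st : size t = d by rewrite size_sort size_codom card_ord.
exists (\col_i nth 0 t i); split.
  move=> i j ij; rewrite !mxE.
  have tS : sorted >=%R t by apply: sort_sorted => x y; rewrite /= orbC le_total.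
  by apply: (sorted_leq_nth ge_trans ge_refl 0 tS); rewrite ?inE ?st.
rewrite Xr; transitivity (\prod_(y <- t) ('X - y%:P)).
  by rewrite (perm_big _ (permEl (perm_sort _ _))) /= big_map big_enum.
rewrite (big_nth 0) st big_mkord; apply: eq_bigr => i _; by rewrite mxE.
Qed.

(** The complex spectral theorem gives nonnegative, hence real, eigenvalues, so
    the characteristic polynomial splits over R.  Unique factorization identifies
    them with [eigenvalues X] up to a permutation, which is absorbed in the
    unitary matrix. *)
Lemma psdmx_eigenvalues (R : realType) d (X : 'M[R]_d) :
  psdmx (map_mx (real_complex R) X) ->
  exists2 U : 'M[R[i]]_d, U \is unitarymx &
    [/\ map_mx (real_complex R) X =
          U ^t* *m diag_mx (\row_j real_complex R (eigenvalues X j 0)) *m U,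
        nonincreasing_vec (eigenvalues X) &
        forall j, 0 <= eigenvalues X j 0].
Proof.
move=> /psdmx_spectral[U [z [Uu XU z0]]].
pose r i := complex.Re (z 0 i).
have zr i : z 0 i = real_complex R (r i) by rewrite RRe_real// ger0_real.
have r0 i : 0 <= r i by rewrite -ler0c -zr.
have Xr : char_poly X = \prod_i ('X - (r i)%:P).
  apply: (@map_poly_inj _ _ (real_complex R)).
  rewrite map_char_poly XU char_poly_similar ?char_poly_diag.
    by rewrite rmorph_prod; apply: eq_bigr => i _; rewrite zr /= map_polyXsubC.
  by rewrite -invmx_unitary// mulVmx// unitarymx_unit.
have [lmon Xl] := eigenvaluesP (ex_intro _ r Xr).
set l := eigenvalues X in lmon Xl *.
have [p lp] : exists p : {perm 'I_d}, forall i, l i 0 = r (p i).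
  have : perm_eq [tuple l i 0 | i < d] [tuple r i | i < d].
    apply: prod_XsubC_eq; rewrite !big_tuple.
    transitivity (char_poly X); [rewrite Xl|rewrite Xr]; apply: eq_bigr => i _;
      by rewrite tnth_mktuple.
  move=> /tuple_permP[p lp]; exists p => i.
  by have /(congr1 (fun s => tnth s i)) := val_inj lp; rewrite !tnth_mktuple.
exists (row_perm p U).
  apply/unitarymxP/matrixP => i j.
  have /unitarymxP/matrixP/(_ (p i) (p j)) := Uu.
  rewrite !mxE (inj_eq perm_inj) => <-.
  by apply: eq_bigr => k _; rewrite !mxE.
split=> //; last by move=> j; rewrite lp.
rewrite XU; apply/matrixP => i j; rewrite !mul_mx_diag !mxE.
rewrite (reindex_inj (@perm_inj _ p)); apply: eq_bigr => k _.
by rewrite !mxE lp zr.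
Qed.

(** If the i-th eigenvalue vanished, so would all later ones, and the rank would
    be at most i (indices start at 0). *)
Lemma psdmx_eigenvalue_gt0 (R : realType) d (X : 'M[R]_d) (i : 'I_d) :
  psdmx (map_mx (real_complex R) X) -> (i < \rank X)%N -> 0 < eigenvalues X i 0.
Proof.
move=> /psdmx_eigenvalues[U Uu [XU lmon l0]] irk.
rewrite lt_neqAle l0 andbT; apply: contraTneq irk => li0.
rewrite -leqNgt -(mxrank_map (real_complex R)) XU.
apply: leq_trans (mxrankM_maxl _ _) _; apply: leq_trans (mxrankM_maxr _ _) _.
set D := diag_mx _.
have -> : D = D *m pid_mx i.
  apply/matrixP => j k; rewrite mul_diag_mx !mxE.
  have [->|jk] := eqVneq j k; last by rewrite val_eqE (negPf jk) mulr0.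
  rewrite eqxx; case: ltnP => ik; first by rewrite mulr1.
  suff -> : eigenvalues X k 0 = 0 by rewrite rmorph0 mul0r mul0rn.
  by apply/eqP; rewrite eq_le l0 andbT li0; exact: lmon.
apply: leq_trans (mxrankM_maxr _ _) _.
by rewrite rank_pid_mx // ltnW.
Qed.

(** * Water levels and the function G *)

Lemma sum_const_ltn (R : realType) d r (c : R) : (r <= d)%N ->
  \sum_(j < d | (j < r)%N) c = r%:R * c.
Proof.
by move=> rd; rewrite -(big_ord_widen d (fun=> c) rd) sumr_const card_ord mulr_natl.
Qed.

(** Intermediate value theorem for
    tau |-> sum_j min(l_j, tau) - (i + 1) tau: it is nonnegative at tau = l_i,
    where i + 1 of the minima equal tau, and nonpositive at the sum of all
    l_j, which bounds the sum of the minima. *)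
Lemma water_level (R : realType) d (l : 'cV[R]_d) (i : 'I_d) :
  nonincreasing_vec l -> (forall j, 0 <= l j 0) -> 0 < l i 0 ->
  exists2 tau : R, 0 < tau & \sum_j Num.min (l j 0) tau = i.+1%:R * tau.
Proof.
move=> lmon l0 li0.
pose g (tau : R) : R := \sum_j Num.min (l j 0) tau - i.+1%:R * tau.
have cg : continuous g.
  move=> t; apply: cvgB; last by apply: cvgM; [exact: cvg_cst|exact: cvg_id].
  apply: cvg_big => [|j _]; first exact: add_continuous.
  by apply: continuous_min; [exact: cvg_cst|exact: cvg_id].
have lel : l i 0 <= \sum_j l j 0 by rewrite (bigD1 i)//= lerDl sumr_ge0.
have g1 : 0 <= g (l i 0).
  rewrite subr_ge0 -(sum_const_ltn _ (ltn_ord i)) [leRHS](bigID (fun j : 'I_d => (j < i.+1)%N))/=.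
  rewrite -[leLHS]addr0 lerD ?sumr_ge0// => [|j _]; last by rewrite le_min l0 ltW.
  by apply: ler_sum => j ji; rewrite le_min lexx andbT lmon.
have g2 : g (\sum_j l j 0) <= 0.
  have s0 : 0 <= \sum_j l j 0 by apply: sumr_ge0.
  rewrite subr_le0; apply: (@le_trans _ _ (\sum_j l j 0)).
    by apply: ler_sum => j _; rewrite ge_min lexx.
  by rewrite ler_peMl// ler1n.
have [] := @IVT R g (l i 0) (\sum_j l j 0) 0 lel.
- exact: continuous_subspaceT.
- by rewrite ge_min g2 orbT /= le_max g1.
move=> tau; rewrite in_itv /= => /andP[ltau _] /eqP; rewrite subr_eq0 => /eqP tauE.
by exists tau => //; exact: lt_le_trans ltau.
Qed.

Lemma sum_largest_sorted (R : realType) d (u : 'cV[R]_d) j : (j <= d)%N ->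
  nonincreasing_vec u -> sum_largest u j = \sum_(i < d | (i < j)%N) u i 0.
Proof.
move=> jd um; rewrite /sum_largest sorted_sort; last 2 first.
- exact: ge_trans.
- rewrite sorted_map; apply: (@sub_sorted _ (fun i k : 'I_d => (i <= k)%N)).
    by move=> i k /=; exact: um.
  have : sorted leq (map val (enum 'I_d)) by rewrite val_enum_ord iota_sorted.
  by rewrite sorted_map.
have takeE : take j (enum 'I_d) = [seq i : 'I_d <- enum 'I_d | (i < j)%N].
  apply: (inj_map val_inj).
  rewrite map_take -[in RHS](filter_map val (fun i => (i < j)%N)) val_enum_ord.
  by rewrite take_iota (minn_idPl jd) (filter_iota_ltn 0 jd).
by rewrite -map_take big_map takeE big_filter big_enum_cond.
Qed.

(** The admissible vector is xi_j = max(l_j, tau) for j < r and 0 afterwards.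
    Since sum_j min(l_j, tau) = r tau, at most r eigenvalues exceed tau; with
    max + min = l + tau this gives xi the same total as l.  Its partial sums
    dominate those of l: entrywise up to r, and since they have reached the
    total beyond r.  The logarithms of max(l_j, tau) / tau are taken over all j
    because those with j >= r vanish. *)
Lemma G_le (R : realType) d r (X : 'M[R]_d) (tau : R) :
  (0 < r <= d)%N -> nonincreasing_vec (eigenvalues X) ->
  (forall j, 0 <= eigenvalues X j 0) -> 0 < tau ->
  \sum_j Num.min (eigenvalues X j 0) tau = r%:R * tau ->
  (G r X <= (- (r%:R * ln tau
                + \sum_j ln (Num.max (eigenvalues X j 0) tau / tau)))%:E)%E.
Proof.
move=> /andP[r0 rd]; set l := eigenvalues X => lmon l0 tau0 ltau.
(* Otherwise r + 1 of the minima would equal tau. *)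
have ltl (j : 'I_d) : (r <= j)%N -> l j 0 <= tau.
  move=> rj; rewrite leNgt; apply/negP => tl.
  have : \sum_(k < d | (k < j.+1)%N) tau <= r%:R * tau.
    rewrite -ltau [leRHS](bigID (fun k : 'I_d => (k < j.+1)%N))/= -[leLHS]addr0.
    rewrite lerD ?sumr_ge0// => [|k _]; last by rewrite le_min l0 ltW.
    apply: ler_sum => k kj; rewrite le_min lexx andbT.
    by apply: le_trans (ltW tl) _; exact: lmon.
  by rewrite sum_const_ltn// ler_pM2r// ler_nat leqNgt ltnS rj.
pose xi : 'cV[R]_d := \col_j (if (j < r)%N then Num.max (l j 0) tau else 0).
have xi0 j : 0 <= xi j 0 by rewrite mxE; case: ifP => // _; rewrite le_max l0.
have ximon : nonincreasing_vec xi.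
  move=> i j ij; have xij := xi0 i; move: xij; rewrite !mxE.
  case: (ltnP j r) => // jr; rewrite (leq_ltn_trans ij jr) => _.
  by rewrite ge_max le_max lmon// le_max lexx orbT.
have xil : \sum_i xi i 0 = \sum_i l i 0.
  have -> : \sum_i xi i 0 = \sum_(i < d) (if (i < r)%N then Num.max (l i 0) tau else 0).
    by apply: eq_bigr => i _; rewrite mxE.
  rewrite -big_mkcond /=.
  have mm : \sum_(i < d | (i < r)%N) Num.max (l i 0) tau
      + \sum_(i < d | (i < r)%N) Num.min (l i 0) tau
      = \sum_(i < d | (i < r)%N) l i 0 + r%:R * tau.
    rewrite -(sum_const_ltn _ rd) -!big_split /=; apply: eq_bigr => i _.
    by rewrite addrC addr_min_max.
  move: ltau; rewrite (bigID (fun k : 'I_d => (k < r)%N))/=.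
  rewrite [X in _ + X](eq_bigr (fun k : 'I_d => l k 0)); last first.
    by move=> k; rewrite -leqNgt => rk; rewrite min_l// ltl.
  rewrite [X in _ -> _ = X](bigID (fun k : 'I_d => (k < r)%N))/=; lra.
have -> : r%:R * ln tau + \sum_j ln (Num.max (l j 0) tau / tau)
    = \sum_(j < d | (j < r)%N) ln (Num.max (l j 0) tau).
  rewrite (bigID (fun j : 'I_d => (j < r)%N))/= [X in _ + (_ + X)]big1.
    rewrite addr0 -(sum_const_ltn _ rd) -big_split /=; apply: eq_bigr => j _.
    by rewrite ln_div ?posrE ?lt_max ?tau0 ?orbT// addrC subrK.
  by move=> j; rewrite -leqNgt => rj; rewrite max_r ?ltl// divff ?ln1 ?gt_eqF.
apply: ereal_inf_lbound; exists xi; first split=> //.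
- split=> // j /andP[j1 jd].
  have jd' : (j <= d)%N by apply: leq_trans jd (leq_subr _ _).
  rewrite !sum_largest_sorted//.
  have [jr|rj] := leqP j r.
    apply: ler_sum => i ij; rewrite mxE (leq_trans ij jr).
    by rewrite le_max lexx.
  suff -> : \sum_(i < d | (i < j)%N) xi i 0 = \sum_i xi i 0.
    rewrite xil [leRHS](bigID (fun k : 'I_d => (k < j)%N))/=.
    by rewrite lerDl sumr_ge0.
  rewrite [RHS](bigID (fun k : 'I_d => (k < j)%N))/= [X in _ + X]big1 ?addr0//.
  move=> i; rewrite -leqNgt => ji; rewrite mxE ltnNge.
  by rewrite (leq_trans (ltnW rj) ji).
rewrite -sumrN -sumEFin; apply: eq_bigr => i ir.
by rewrite mxE ir /neglog lt_max tau0 orbT.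
Qed.

(** * Ranks of diagonal matrices *)

(** Adding to diag(a) the indicator of the zeros of a makes it invertible and
    raises the rank by at most the number of these zeros. *)
Lemma rank_diag_mx_ge (F : fieldType) n (a : 'rV[F]_n) :
  (#|[pred i | a 0%R i != 0%R]| <= \rank (diag_mx a))%N.
Proof.
pose b : 'rV[F]_n := \row_i (a 0 i == 0)%:R.
have bE : diag_mx b = \sum_(i | a 0%R i == 0) delta_mx i i.
  apply/matrixP => i j; rewrite summxE !mxE big_mkcond /= (bigD1 i)//= big1 ?addr0.
    by case: ifP => _; rewrite ?mxE ?eqxx ?(eq_sym j i) //= mul0rn.
  by move=> k ki; case: ifP => // _; rewrite mxE eq_sym (negPf ki).
have rb : (\rank (diag_mx b) <= #|[pred i | a 0%R i == 0%R]|)%N.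
  rewrite bE -sum1_card.
  elim/big_rec2: _ => [|i k M _ Mk]; first by rewrite mxrank0.
  by rewrite (leq_trans (mxrank_add _ _))// leq_add// mxrank_delta.
have rab : \rank (diag_mx a + diag_mx b)%R = n.
  have -> : diag_mx a + diag_mx b = diag_mx (a + b).
    by apply/matrixP => i j; rewrite !mxE mulrnDl.
  apply: mxrank_unit; rewrite unitmxE unitfE det_diag.
  apply/prodf_neq0 => i _; rewrite !mxE.
  by have [->|ai] := eqVneq (a 0 i) 0; rewrite ?add0r ?oner_neq0 ?addr0.
have := mxrank_add (diag_mx a) (diag_mx b); rewrite rab => nab.
have := cardC [pred i | a 0%R i != 0%R]; rewrite card_ord.
have -> : #|[predC [pred i | a 0%R i != 0%R]]| = #|[pred i | a 0%R i == 0%R]|.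
  by apply: eq_card => i; rewrite !inE negbK.
move=> cE; rewrite -(leq_add2r #|[pred i | a 0%R i == 0%R]|) cE.
by apply: leq_trans nab _; rewrite leq_add2l.
Qed.

(** Entries at most 1 with sum r force at least r nonzero entries. *)
Lemma rank_Diag_ge (R : realType) d r (x : 'cV[R]_d) :
  (forall i, 0 <= x i 0 <= 1) -> \sum_i x i 0 = r%:R -> (r <= \rank (Diag x))%N.
Proof.
move=> x01 xr; apply: leq_trans (rank_diag_mx_ge _).
rewrite -(ler_nat R) -xr -sum1_card natr_sum [leRHS]big_mkcond /=.
apply: ler_sum => i _; rewrite inE mxE.
by case: eqVneq => [->//|_]; case/andP: (x01 i).
Qed.

Lemma rank_unit_mul (F : fieldType) n (M N Z : 'M[F]_n) :
  M \in unitmx -> N \in unitmx -> \rank (M *m Z *m N) = \rank Z.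
Proof.
move=> Mu Nu; rewrite mxrankMfree ?row_free_unit//.
by rewrite -mxrank_tr trmx_mul mxrankMfree ?row_free_unit ?unitmx_tr// mxrank_tr.
Qed.

(** * The main inequality *)

Lemma psdmx_Diag_congr (R : realType) d (M : 'M[R]_d) (p : 'cV[R]_d) :
  (forall i, 0 <= p i 0) ->
  psdmx (map_mx (real_complex R) (M *m Diag p *m M^T)).
Proof.
move=> p0; rewrite !map_mxM /=.
have -> : map_mx (real_complex R) M^T = (map_mx (real_complex R) M) ^t*.
  apply/matrixP => i j; rewrite !mxE; apply/esym/CrealP/complex_realP.
  by exists (M j i).
apply: psdmx_congr; rewrite map_diag_mx; apply: psdmx_diag => i.
by rewrite !mxE ler0c.
Qed.

Lemma G_water_level (R : realType) d r (X : 'M[R]_d) :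
  psdmx (map_mx (real_complex R) X) -> (0 < r <= \rank X)%N ->
  exists tau : R, [/\ 0 < tau,
    \sum_j Num.min (eigenvalues X j 0) tau = r%:R * tau &
    (G r X <= (- (r%:R * ln tau
                  + \sum_j ln (Num.max (eigenvalues X j 0) tau / tau)))%:E)%E].
Proof.
move=> Xp /andP[r0 rX].
have rd : (r <= d)%N by apply: leq_trans rX (rank_leq_row X).
have [_ _ [_ lmon l0]] := psdmx_eigenvalues Xp.
have rd' : (r.-1 < d)%N by rewrite prednK.
have [] := water_level (i := Ordinal rd') lmon l0.
  by apply: psdmx_eigenvalue_gt0 => //=; rewrite prednK.
rewrite /= prednK// => tau tau0 tauE.
by exists tau; split=> //; apply: G_le => //; rewrite r0.
Qed.

(** [det_unitaryD_le] for the eigenvalues of X / t and Y / u, each factored as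
    max(l, t) / t times min(l, t) / t. *)
Lemma det_scaled_sum_le (R : realType) d (X Y : 'M[R]_d) (t u : R) :
  psdmx (map_mx (real_complex R) X) -> psdmx (map_mx (real_complex R) Y) ->
  0 < t -> 0 < u ->
  (\sum_j Num.min (eigenvalues X j 0) t) / t
  + (\sum_j Num.min (eigenvalues Y j 0) u) / u <= d%:R ->
  \det (t^-1 *: X + u^-1 *: Y) <=
    (\prod_j (Num.max (eigenvalues X j 0) t / t))
    * (\prod_j (Num.max (eigenvalues Y j 0) u / u)).
Proof.
move=> /psdmx_eigenvalues[U Uu [XE _ X0]] /psdmx_eigenvalues[W Wu [YE _ Y0]].
move=> t0 u0 tu.
have scaleE (Q : 'M[R[i]]_d) (l : 'cV[R]_d) (a : R) : 0 < a ->
    real_complex R a^-1 *: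
      (Q ^t* *m diag_mx (\row_j real_complex R (l j 0)) *m Q)
    = Q ^t* *m diag_mx (\row_j (real_complex R (Num.max (l j 0) a / a)
                         * real_complex R (Num.min (l j 0) a / a))) *m Q.
  move=> a0; rewrite scalemxAl scalemxAr; congr (_ *m _ *m _).
  apply/matrixP => i j; rewrite !mxE mulrnAr -!rmorphM /=.
  congr (real_complex R _ *+ _).
  by case: (leP (l i 0) a) => la; field; rewrite gt_eqF.
rewrite -lecR -det_map_mx map_mxD !map_mxZ XE YE !scaleE// rmorphM !rmorph_prod.
apply: det_unitaryD_le => // [j|j|j|j|].
- by rewrite ler0c divr_ge0 ?le_min ?X0 ?ltW.
- by rewrite -(rmorph1 (real_complex R)) lecR ler_pdivlMr// mul1r le_max lexx orbT.
- by rewrite ler0c divr_ge0 ?le_min ?Y0 ?ltW.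
- by rewrite -(rmorph1 (real_complex R)) lecR ler_pdivlMr// mul1r le_max lexx orbT.
rewrite -!rmorph_sum -rmorphD -(rmorph_nat (real_complex R)) lecR.
by rewrite -!mulr_suml.
Qed.

Theorem proposition11 (R : realType) (d s m : nat)
    (hs : (1 <= s <= d - 1)%N)
    (A : 'M[R]_(m, d)) (b : 'cV[R]_m)
    (C V : 'M[R]_d) (hV : \rank V = d) (hC : C = V^T *m V)
    (x : 'cV[R]_d) (hx : polytope s A b x) (rho omega : 'cV[R]_d) :
  exists kappa : R,
    ((2^-1)%:E * (f_Gamma_g s V x rho + f_Gammac_g s C V x omega)
     <= f_linx_d C x (rho + kappa *: ones R d) omega)%E.
Proof.
case: hx => x01 xs _; case/andP: hs => s1 sd.
have sd' : (s <= d)%N by apply: leq_trans sd (leq_subr _ _).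
have Vu : V \in unitmx by rewrite -row_free_unit /row_free hV.
have DiagM (e y : 'cV[R]_d) : Diag (vexp e) *m Diag y = Diag (\col_i (expR (e i 0) * y i 0)).
  apply/matrixP => i j; rewrite mul_diag_mx !mxE.
  by case: eqVneq => [->|_]; rewrite ?mulr1n ?mulr0n ?mulr0.
have Diagu (e : 'cV[R]_d) : Diag (vexp e) \in unitmx.
  rewrite unitmxE unitfE det_diag; apply/prodf_neq0 => i _.
  by rewrite !mxE gt_eqF// expR_gt0.
set X := V *m Diag (vexp rho) *m Diag x *m V^T.
set Y := (invmx V)^T *m Diag (vexp omega) *m Diag (ones R d - x) *m invmx V.
have Xp : psdmx (map_mx (real_complex R) X).
  rewrite /X -(mulmxA V) DiagM; apply: psdmx_Diag_congr => i.
  by rewrite mxE mulr_ge0 ?expR_ge0//; case/andP: (x01 i).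
have Yp : psdmx (map_mx (real_complex R) Y).
  rewrite /Y -(mulmxA (invmx V)^T) DiagM -[in X in _ *m X](trmxK (invmx V)).
  apply: psdmx_Diag_congr => i.
  by rewrite !mxE mulr_ge0 ?expR_ge0// subr_ge0; case/andP: (x01 i).
have rX : (s <= \rank X)%N.
  by rewrite /X rank_unit_mul ?unitmx_mul ?Vu ?Diagu ?unitmx_tr// rank_Diag_ge.
have rY : (d - s <= \rank Y)%N.
  rewrite /Y rank_unit_mul ?unitmx_mul ?unitmx_tr ?unitmx_inv ?Vu ?Diagu//.
  apply: rank_Diag_ge => [i|].
    by rewrite !mxE; case/andP: (x01 i) => ? ?; apply/andP; split; lra.
  rewrite natrB// -xs; under eq_bigr do rewrite !mxE.
  by rewrite sumrB sumr_const card_ord.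
have [t [t0 tE Gt]] : _ := G_water_level Xp (introT andP (conj s1 rX)).
have [|u [u0 uE Gu]] := G_water_level (r := d - s) Yp.
  by rewrite rY andbT subn_gt0; apply: leq_ltn_trans sd _; rewrite subn1 prednK//; apply: leq_trans sd'.
set a := \sum_j ln _ in Gt; set c := \sum_j ln _ in Gu.
(* e^kappa = u / t brings the water level of X to that of Y. *)
exists (ln (u / t)).
have ut0 : 0 < u / t by rewrite divr_gt0.
set D := \det (t^-1 *: X + u^-1 *: Y).
have detC : \det C = \det V ^+ 2 by rewrite hC det_mulmx det_tr expr2.
have C0 : 0 < \det C.
  by rewrite detC exprn_even_gt0//= -unitfE -unitmxE.
have detM : \det (C *m Diag (vexp (rho + ln (u / t) *: ones R d)) *m Diag x *m C
    + Diag (vexp omega) *m Diag (ones R d - x)) = \det C * (u ^+ d * D).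
  have -> : Diag (vexp (rho + ln (u / t) *: ones R d)) = (u / t) *: Diag (vexp rho).
    apply/matrixP => i j; rewrite !mxE mulr1 expRD lnK ?posrE// mulrC.
    by rewrite mulrnAr.
  have -> : \det C * (u ^+ d * D)
      = \det (V^T *m (u *: (t^-1 *: X + u^-1 *: Y)) *m V).
    by rewrite !det_mulmx det_tr detZ -/D detC; ring.
  congr (\det _); rewrite scalerDr !scalerA divff ?gt_eqF// scale1r.
  rewrite mulmxDr mulmxDl hC /X /Y -!scalemxAr -!scalemxAl !mulmxA.
  congr (_ *: _ + _).
  by rewrite -trmx_mul mulVmx// trmx1 mul1mx -mulmxA mulVmx// mulmx1.
have Dle : D <= (\prod_j (Num.max (eigenvalues X j 0) t / t))
    * (\prod_j (Num.max (eigenvalues Y j 0) u / u)).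
  apply: det_scaled_sum_le => //.
  by rewrite tE uE !mulfK ?gt_eqF// -natrD subnKC.
have lnprod (l : 'cV[R]_d) (w : R) : 0 < w ->
    0 < \prod_j (Num.max (l j 0) w / w) /\
    ln (\prod_j (Num.max (l j 0) w / w)) = \sum_j ln (Num.max (l j 0) w / w).
  move=> w0; elim/big_rec2: _ => [|j y z _ [z0 <-]]; first by rewrite ln1.
  have j0 : 0 < Num.max (l j 0) w / w by rewrite divr_gt0// lt_max w0 orbT.
  by rewrite mulr_gt0// lnM ?posrE.
rewrite /f_linx_d detM /f_Gamma_g /f_Gammac_g -/X -/Y.
have -> : neglog (\det C) = (- ln (\det C))%:E by rewrite /neglog C0.
rewrite {1}/neglog; case: ifPn => [M0|_]; last first.
  (* A nonpositive determinant makes the left-hand function infinite. *)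
  by rewrite mulry gtr0_sg ?invr_gt0// mul1e; rewrite -?EFinD; exact: leey.
have D0 : 0 < D by move: M0; rewrite !pmulr_rgt0// exprn_gt0.
have lnD : ln D <= a + c.
  have [p0 pE] := lnprod (eigenvalues X) t t0.
  have [q0 qE] := lnprod (eigenvalues Y) u u0.
  by rewrite /a /c -pE -qE -lnM ?posrE// ler_ln ?posrE// mulr_gt0.
have sumk : \sum_i x i 0 * (rho + ln (u / t) *: ones R d) i 0
    = \sum_i x i 0 * rho i 0 + s%:R * (ln u - ln t).
  rewrite -xs mulr_suml -big_split /=; apply: eq_bigr => i _.
  by rewrite !mxE mulr1 mulrDr ln_div.
rewrite sumk.
apply: (@le_trans _ _ ((2^-1)%:E * ((- (s%:R * ln t + a))%:E + (\sum_i x i 0 * rho i 0)%:E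
   + ((- ((d - s)%:R * ln u + c))%:E + (- ln (\det C))%:E
      + (\sum_i (1 - x i 0) * omega i 0)%:E)))%E).
  by rewrite lee_wpmul2l ?lee_fin ?invr_ge0// !leeD.
rewrite -!(EFinD, EFinM) lee_fin.
have -> : ln (\det C * (u ^+ d * D)) = ln (\det C) + (d%:R * ln u + ln D).
  by rewrite lnM ?posrE ?mulr_gt0 ?exprn_gt0// lnM ?posrE ?exprn_gt0// lnXn// mulr_natl.
rewrite natrB//; lra.
Qed.
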